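(* Let $n\in\{0,1,2,\dots\}$. (i) For every $\delta\in(0,n+1)$ the function $s\mapsto E_{n,\delta}(s)$ on $[0,\infty)$ has a unique maximizer $s_n(\delta)>0$. The function $\delta\mapsto s_n(\delta)$ is strictly decreasing on $(0,n+1)$, with $s_n(\delta)\to+\infty$ as $\delta\downarrow 0$ and $s_n(\delta)\to 0$ as $\delta\uparrow n+1$. (ii) For every $\delta\in(n,n+1)$ the function $u\mapsto G_{n,\delta}(u)$ on $[0,\infty)$ has a unique maximizer $u_n(\delta)>0$. The function $\delta\mapsto u_n(\delta)$ is strictly decreasing on $(n,n+1)$, with $u_n(\delta)\to+\infty$ as $\delta\downarrow n$ and $u_n(\delta)\to 0$ as $\delta\uparrow n+1$.
   Context: For $n\in\{0,1,2,\dots\}$ and $\delta\in(0,n+1)$, $$E_{n,\delta}(s)=\frac{1-\Bigl(1+\frac{s^1}{1!}+\dots+\frac{s^n}{n!}\Bigr)e^{-s}}{s^{\delta}}\quad(s>0),\qquad E_{n,\delta}(0)=0.$$ For $n\in\{0,1,2,\dots\}$ and $\delta\in(n,n+1)$, $$G_{n,\delta}(u)=(-1)^{n+1}\,\frac{e^{-u}-\Bigl(1-\frac{u^1}{1!}+\dots+(-1)^n\frac{u^n}{n!}\Bigr)}{u^{\delta}}\quad(u>0),\qquad G_{n,\delta}(0)=0.$$ *)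

(* Defs.v *)
(* Stdlib reals, with Coquelicot for the limits. *)
From Stdlib Require Import Reals Factorial.
From Coquelicot Require Import Coquelicot.
Open Scope R_scope.

(* Both functions are used on [0, oo) only; the value 0 for a negative
   argument is irrelevant.  [sum_f_R0 f n] has the n + 1 terms f 0, ..., f n,
   and [Rpower] is the real power for a positive base. *)
Definition E (n : nat) (delta s : R) : R :=
  if Rlt_dec 0 s then
    (1 - sum_f_R0 (fun k => s ^ k / INR (fact k)) n * exp (- s))
      / Rpower s delta
  else 0.

Definition G (n : nat) (delta u : R) : R :=
  if Rlt_dec 0 u then
    (-1) ^ (n + 1) *
    ((exp (- u) - sum_f_R0 (fun k => (-1) ^ k * (u ^ k / INR (fact k))) n)
      / Rpower u delta)
  else 0.

Definition is_maximizer_on (D : R -> Prop) (f : R -> R) (x : R) : Prop :=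
  D x /\ forall y : R, D y -> f y <= f x.

Definition half_line (x : R) : Prop := 0 <= x.

Definition strictly_decreasing_on (D : R -> Prop) (f : R -> R) : Prop :=
  forall x y : R, D x -> D y -> x < y -> f y < f x.

(* Main.v *)
Require Import Defs.
From Stdlib Require Import Reals Ranalysis5 Factorial Lra Lia ClassicalEpsilon.
From Coquelicot Require Import Coquelicot.
Open Scope R_scope.

(** For a positive differentiable numerator [N] and [h x = x * N' x / N x], the
    derivative of [N x / x ^ d] is [N x / x ^ (d + 1) * (h x - d)].  So if [h]
    is continuous and decreases strictly from [b] to [a], then for [d] in
    [(a, b)] the quotient increases up to the only point with [h x = d] and
    decreases afterwards: the maximizer is the inverse function of [h].  Its
    monotonicity and its limits at [a] and at [b] are those of an inverse
    function ([maximizers_of_controlled_elasticity]).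

    The behaviour of [h] comes from the monotone form of l'Hopital's rule:
    [h] is the quotient of [x * N' x] and [N x], both vanishing at 0, so it is
    strictly decreasing as soon as the quotient [r] of their derivatives is.
    Moreover [h x] is a value of [r] on [(0, x)] ([elasticity_mean_value]),
    which transfers to [h] the bounds [b - x <= r x < b].

    - For [E], [N] is 1 minus the partial exponential sum times [exp (- x)].
      Its derivative is [x ^ n / n! * exp (- x)], hence [r x = n + 1 - x].
    - For [G], the numerators for successive [n] are primitives of one
      another, starting from [exp (- u)].  Hence [r u = 1 - u] for [n = 0], and
      for larger [n], [r] is 1 plus the function [h] of the preceding
      numerator: monotonicity and the bounds [n < h < n + 1] follow by
      induction ([exp_remainder_controlled]).

    That [h] comes arbitrarily close to [a] needs no computation.  If it stayed
    above some [d > a], then [N] would grow at least like [x ^ d], whereas it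
    is at most of order [x ^ a]: the numerator of [E] is at most 1, that of [G]
    at most [u ^ n / n!] ([elasticity_small_somewhere]). *)

(** * Elasticity and the monotone l'Hopital rule *)

Definition positive (x : R) : Prop := 0 < x.

Definition elasticity (N dN : R -> R) (x : R) : R := x * dN x / N x.

(** The quantitative lower bound [b - x] does the work of a limit [b] at 0: it
    is inherited by mean values, since they are taken at points of [(0, x)]. *)
Record controlled_elasticity (N dN : R -> R) (a b : R) : Prop := {
  elasticity_decreasing : strictly_decreasing_on positive (elasticity N dN);
  elasticity_gt : forall x, 0 < x -> a < elasticity N dN x;
  elasticity_near_0 : forall x, 0 < x -> b - x < elasticity N dN x < b }.

Lemma derive_pos_increasing (f df : R -> R) (x y : R) :
  x < y ->
  (forall t, x <= t <= y -> is_derive f t (df t)) ->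
  (forall t, x < t < y -> 0 < df t) ->
  f x < f y.
Proof.
  intros Hxy Hd Hpos.
  destruct (MVT_cor2 f df x y Hxy) as [c [Hc Hin]].
  { intros t Ht; apply is_derive_Reals, Hd, Ht. }
  specialize (Hpos c Hin); nra.
Qed.

Lemma derive_neg_decreasing (f df : R -> R) (x y : R) :
  x < y ->
  (forall t, x <= t <= y -> is_derive f t (df t)) ->
  (forall t, x < t < y -> df t < 0) ->
  f y < f x.
Proof.
  intros Hxy Hd Hneg.
  destruct (MVT_cor2 f df x y Hxy) as [c [Hc Hin]].
  { intros t Ht; apply is_derive_Reals, Hd, Ht. }
  specialize (Hneg c Hin); nra.
Qed.

(** Cauchy's mean value theorem, with the quotient [r] of the derivatives as
    data: [f'] and [g'] may then both vanish at the left end. *)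
Lemma cauchy_mean_value (f g r dg : R -> R) (x y : R) :
  x < y ->
  (forall t, x <= t <= y -> is_derive g t (dg t)) ->
  (forall t, x <= t <= y -> is_derive f t (r t * dg t)) ->
  (forall t, x < t < y -> 0 < dg t) ->
  exists c, x < c < y /\ f y - f x = r c * (g y - g x).
Proof.
  intros Hxy Hg Hf Hpos.
  destruct (MVT_cor2
      (fun t => (f y - f x) * g t - (g y - g x) * f t)
      (fun t => (f y - f x) * dg t - (g y - g x) * (r t * dg t)) x y Hxy)
    as [c [Hc Hin]].
  { intros t Ht; apply is_derive_Reals.
    apply (is_derive_minus (V := R_NormedModule));
      apply (is_derive_scal (fun u => _ u)); auto. }
  exists c; split; [exact Hin|].
  specialize (Hpos c Hin).
  assert (H0 : ((f y - f x) - r c * (g y - g x)) * (dg c * (y - x)) = 0) by lra.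
  apply Rmult_integral in H0; destruct H0 as [H0|H0]; nra.
Qed.

(** For [x < y], [f x = r c * g x] with [c < x], while the increments of [f] and
    [g] from [x] to [y] have the quotient [r d < r c] with [d > x].  So
    [f y < r c * g x + r c * (g y - g x)]. *)
Lemma monotone_lhopital (f g r dg : R -> R) :
  f 0 = 0 -> g 0 = 0 ->
  (forall x, 0 <= x -> is_derive g x (dg x)) ->
  (forall x, 0 <= x -> is_derive f x (r x * dg x)) ->
  (forall x, 0 < x -> 0 < dg x) ->
  strictly_decreasing_on positive r ->
  strictly_decreasing_on positive (fun x => f x / g x).
Proof.
  unfold strictly_decreasing_on, positive.
  intros Hf0 Hg0 Hg Hf Hpos Hr x y Hx Hy Hxy.
  assert (Hgx : g 0 < g x)
    by (apply (derive_pos_increasing g dg); auto with real; intros; [apply Hg|apply Hpos]; lra).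
  assert (Hgy : g x < g y)
    by (apply (derive_pos_increasing g dg); auto with real; intros; [apply Hg|apply Hpos]; lra).
  destruct (cauchy_mean_value f g r dg 0 x) as [c [Hc Ec]]; trivial;
    try (intros; (apply Hg || apply Hf || apply Hpos); lra).
  destruct (cauchy_mean_value f g r dg x y) as [d [Hd Ed]]; trivial;
    try (intros; (apply Hg || apply Hf || apply Hpos); lra).
  assert (Hrdc : r d < r c) by (apply Hr; lra).
  rewrite Hf0, Hg0 in Ec; rewrite Hg0 in Hgx.
  replace (f x / g x) with (r c).
  2:{ replace (f x) with (r c * g x) by lra. field; lra. }
  apply (Rmult_lt_reg_r (g y)); [lra|].
  replace (f y / g y * g y) with (f y) by (field; lra).
  assert (r d * (g y - g x) < r c * (g y - g x)) by (apply Rmult_lt_compat_r; lra).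
  lra.
Qed.

Lemma elasticity_mean_value (N dN r : R -> R) (x : R) :
  N 0 = 0 ->
  (forall t, 0 <= t -> is_derive N t (dN t)) ->
  (forall t, 0 <= t -> is_derive (fun u => u * dN u) t (r t * dN t)) ->
  (forall t, 0 < t -> 0 < dN t) ->
  0 < x ->
  exists c, 0 < c < x /\ elasticity N dN x = r c.
Proof.
  intros HN0 HN HD Hpos Hx.
  assert (HNx : N 0 < N x)
    by (apply (derive_pos_increasing N dN); auto with real; intros; [apply HN|apply Hpos]; lra).
  destruct (cauchy_mean_value (fun u => u * dN u) N r dN 0 x) as [c [Hc Ec]]; trivial;
    try (intros; (apply HN || apply HD || apply Hpos); lra).
  exists c; split; [exact Hc|].
  cbv beta in Ec; rewrite HN0, Rmult_0_l in Ec; rewrite HN0 in HNx.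
  unfold elasticity.
  replace (x * dN x) with (r c * N x) by lra.
  field; lra.
Qed.

Lemma controlled_elasticity_of_derivative (N dN r : R -> R) (a b : R) :
  N 0 = 0 ->
  (forall t, 0 <= t -> is_derive N t (dN t)) ->
  (forall t, 0 <= t -> is_derive (fun u => u * dN u) t (r t * dN t)) ->
  (forall t, 0 < t -> 0 < dN t) ->
  strictly_decreasing_on positive r ->
  (forall x, 0 < x -> b - x <= r x < b) ->
  (forall x, 0 < x -> a < elasticity N dN x) ->
  controlled_elasticity N dN a b.
Proof.
  intros HN0 HN HD Hpos Hr Hb Ha.
  split; [|exact Ha|].
  - apply (monotone_lhopital (fun u => u * dN u) N r dN); auto; ring.
  - intros x Hx.
    destruct (elasticity_mean_value N dN r x) as [c [Hc ->]]; auto.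
    specialize (Hb c (proj1 Hc)); lra.
Qed.

(** * From the elasticity to the maximizer *)

Lemma is_derive_quotient_power (N dN : R -> R) (d x : R) :
  0 < x -> 0 < N x ->
  is_derive N x (dN x) ->
  is_derive (fun t => N t / Rpower t d) x
    (N x / Rpower x d / x * (elasticity N dN x - d)).
Proof.
  intros Hx HNx HN.
  assert (Hp : is_derive (fun t => Rpower t d) x (Rpower x d * (d / x))).
  { unfold Rpower; auto_derive; [exact Hx|].
    field; lra. }
  assert (Hpos : 0 < Rpower x d) by apply exp_pos.
  replace (N x / Rpower x d / x * (elasticity N dN x - d))
    with ((dN x * Rpower x d - N x * (Rpower x d * (d / x))) / (Rpower x d) ^ 2).
  - apply (is_derive_div N (fun t => Rpower t d)); auto; lra.
  - unfold elasticity; field; repeat split; lra.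
Qed.

Lemma quotient_power_increasing (N dN : R -> R) (d x y : R) :
  0 < x < y ->
  (forall t, 0 < t -> 0 < N t) ->
  (forall t, 0 <= t -> is_derive N t (dN t)) ->
  (forall t, x < t < y -> d < elasticity N dN t) ->
  N x / Rpower x d < N y / Rpower y d.
Proof.
  intros Hxy HNpos HN He.
  apply (derive_pos_increasing (fun t => N t / Rpower t d)
           (fun t => N t / Rpower t d / t * (elasticity N dN t - d)));
    [lra| |].
  - intros t Ht; apply is_derive_quotient_power;
      [lra|apply HNpos; lra|apply HN; lra].
  - intros t Ht. specialize (He t Ht).
    apply Rmult_lt_0_compat; [|lra].
    apply Rdiv_lt_0_compat; [|lra].
    apply Rdiv_lt_0_compat; [apply HNpos; lra|apply exp_pos].
Qed.

Lemma quotient_power_decreasing (N dN : R -> R) (d x y : R) :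
  0 < x < y ->
  (forall t, 0 < t -> 0 < N t) ->
  (forall t, 0 <= t -> is_derive N t (dN t)) ->
  (forall t, x < t < y -> elasticity N dN t < d) ->
  N y / Rpower y d < N x / Rpower x d.
Proof.
  intros Hxy HNpos HN He.
  apply (derive_neg_decreasing (fun t => N t / Rpower t d)
           (fun t => N t / Rpower t d / t * (elasticity N dN t - d)));
    [lra| |].
  - intros t Ht; apply is_derive_quotient_power;
      [lra|apply HNpos; lra|apply HN; lra].
  - intros t Ht. specialize (He t Ht).
    assert (0 < N t / Rpower t d / t).
    { apply Rdiv_lt_0_compat; [|lra].
      apply Rdiv_lt_0_compat; [apply HNpos; lra|apply exp_pos]. }
    nra.
Qed.

(** Otherwise [N x / x ^ d] would be increasing beyond 1, and [N x] would
    exceed [N 1 * x ^ d] there, which for large [x] is more than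
    [C * x ^ a]. *)
Lemma elasticity_small_somewhere (N dN : R -> R) (a C d : R) :
  (forall t, 0 < t -> 0 < N t) ->
  (forall t, 0 <= t -> is_derive N t (dN t)) ->
  (forall t, 0 < t -> N t <= C * Rpower t a) ->
  strictly_decreasing_on positive (elasticity N dN) ->
  a < d ->
  exists y, 0 < y /\ elasticity N dN y < d.
Proof.
  intros HNpos HN HC Hdec Had.
  apply NNPP; intros Hno.
  assert (Hge : forall y, 0 < y -> d <= elasticity N dN y).
  { intros y Hy. apply Rnot_lt_le. intros H; apply Hno; exists y; auto. }
  assert (HN1 : 0 < N 1) by (apply HNpos; lra).
  assert (HCN : 0 < C).
  { specialize (HC 1 Rlt_0_1). unfold Rpower in HC. rewrite ln_1, Rmult_0_r, exp_0 in HC. lra. }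
  (* [N 1 * Y ^ d] exceeds [C * Y ^ a] once [ln Y > ln (C / N 1) / (d - a)];
     the absolute value also puts [Y = exp L] beyond 1. *)
  set (L := (Rabs (ln (C / N 1)) + 1) / (d - a)).
  assert (HL : 0 < L).
  { apply Rdiv_lt_0_compat; [|lra]. pose proof (Rabs_pos (ln (C / N 1))); lra. }
  assert (H1 : 1 < exp L) by (rewrite <- exp_0; apply exp_increasing; exact HL).
  assert (Hinc : N 1 / Rpower 1 d < N (exp L) / Rpower (exp L) d).
  { apply (quotient_power_increasing N dN); auto; [lra|].
    intros t Ht. apply Rle_lt_trans with (elasticity N dN (exp L)).
    - apply Hge; lra.
    - apply Hdec; unfold positive; lra. }
  specialize (HC (exp L) (exp_pos _)).
  unfold Rpower in *. rewrite ln_1, Rmult_0_r, exp_0, Rdiv_1_r in Hinc.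
  rewrite ln_exp in Hinc, HC.
  apply (Rmult_lt_compat_r (exp (d * L)) _ _ (exp_pos _)) in Hinc.
  replace (N (exp L) / exp (d * L) * exp (d * L)) with (N (exp L)) in Hinc
    by (field; apply Rgt_not_eq, exp_pos).
  assert (Hlt : N 1 * exp (d * L) < C * exp (a * L)) by lra.
  assert (HE : exp (d * L) = exp (a * L) * exp ((d - a) * L))
    by (rewrite <- exp_plus; f_equal; ring).
  assert (HdL : (d - a) * L = Rabs (ln (C / N 1)) + 1) by (unfold L; field; lra).
  assert (HCle : C / N 1 < exp ((d - a) * L)).
  { rewrite <- (exp_ln (C / N 1)) at 1 by (apply Rdiv_lt_0_compat; lra).
    apply exp_increasing. rewrite HdL. pose proof (Rle_abs (ln (C / N 1))); lra. }
  apply (Rmult_lt_compat_r (N 1) _ _ HN1) in HCle.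
  replace (C / N 1 * N 1) with C in HCle by (field; lra).
  pose proof (exp_pos (a * L)).
  rewrite HE in Hlt. nra.
Qed.

(** Intermediate values between [b - d], where the elasticity exceeds
    [b - (b - d) = d], and a point where it is below [d]. *)
Lemma elasticity_reaches (N dN dD : R -> R) (a b C d : R) :
  (forall t, 0 < t -> 0 < N t) ->
  (forall t, 0 <= t -> is_derive N t (dN t)) ->
  (forall t, 0 <= t -> is_derive (fun u => u * dN u) t (dD t)) ->
  (forall t, 0 < t -> N t <= C * Rpower t a) ->
  controlled_elasticity N dN a b ->
  a < d < b ->
  exists x, 0 < x /\ elasticity N dN x = d.
Proof.
  intros HNpos HN HD HC He Hd.
  destruct (elasticity_small_somewhere N dN a C d) as [y [Hy Hyd]]; auto;
    [apply He|lra|].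
  assert (Hx : 0 < b - d) by lra.
  pose proof (elasticity_near_0 _ _ _ _ He _ Hx) as Hxd.
  assert (Hlt : b - d < y).
  { apply Rnot_le_lt; intros [Hc|Hc].
    - apply (elasticity_decreasing _ _ _ _ He) in Hc; auto; lra.
    - rewrite <- Hc in Hxd; lra. }
  destruct (IVT_interv (fun t => d - elasticity N dN t) (b - d) y) as [z [Hz Ez]];
    [|lra|lra|lra|].
  - intros t Ht. apply continuity_pt_filterlim.
    apply (ex_derive_continuous (fun t => d - elasticity N dN t)).
    apply (ex_derive_minus (fun _ => d)); [apply ex_derive_const|].
    unfold elasticity. apply (ex_derive_div (fun t => t * dN t)).
    + exists (dD t); apply HD; lra.
    + exists (dN t); apply HN; lra.
    + apply Rgt_not_eq, HNpos; lra.
  - exists z; split; lra.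
Qed.

Lemma maximizer_of_elasticity (N dN f : R -> R) (d x : R) :
  (forall t, 0 < t -> 0 < N t) ->
  (forall t, 0 <= t -> is_derive N t (dN t)) ->
  strictly_decreasing_on positive (elasticity N dN) ->
  f 0 = 0 ->
  (forall t, 0 < t -> f t = N t / Rpower t d) ->
  0 < x -> elasticity N dN x = d ->
  unique (is_maximizer_on half_line f) x.
Proof.
  intros HNpos HN Hdec Hf0 Hf Hx Ex.
  assert (Hlt : forall y, half_line y -> y <> x -> f y < f x).
  { unfold half_line; intros y [Hy|Hy] Hyx.
    - rewrite !Hf by trivial.
      destruct (Rdichotomy _ _ Hyx) as [H|H].
      + apply (quotient_power_increasing N dN); auto; intros t Ht.
        rewrite <- Ex; apply Hdec; unfold positive; lra.
      + apply (quotient_power_decreasing N dN); auto; intros t Ht.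
        rewrite <- Ex; apply Hdec; unfold positive; lra.
    - rewrite <- Hy, Hf0, Hf by trivial.
      apply Rdiv_lt_0_compat; [auto|apply exp_pos]. }
  split.
  - split; [unfold half_line; lra|]. intros y Hy.
    destruct (Req_dec y x) as [->|Hyx]; [apply Rle_refl|].
    apply Rlt_le, Hlt; auto.
  - intros y [Hy Hmax].
    destruct (Req_dec y x) as [->|Hyx]; [reflexivity|].
    specialize (Hlt y Hy Hyx). specialize (Hmax x (Rlt_le _ _ Hx)). lra.
Qed.

(** The [dD] hypothesis only serves the continuity of the elasticity.  For the
    limit at [a], the maximizer exceeds [m] as soon as [a < d < h m]; for the
    limit at [b], it is below [eps] as soon as [h eps < d < b]. *)
Lemma maximizers_of_controlled_elasticity
    (N dN dD : R -> R) (f : R -> R -> R) (a b C : R) :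
  (forall t, 0 < t -> 0 < N t) ->
  (forall t, 0 <= t -> is_derive N t (dN t)) ->
  (forall t, 0 <= t -> is_derive (fun u => u * dN u) t (dD t)) ->
  (forall t, 0 < t -> N t <= C * Rpower t a) ->
  controlled_elasticity N dN a b ->
  (forall d, f d 0 = 0) ->
  (forall d t, 0 < t -> f d t = N t / Rpower t d) ->
  exists s : R -> R,
    (forall d, a < d < b ->
       unique (is_maximizer_on half_line (f d)) (s d) /\ 0 < s d) /\
    strictly_decreasing_on (fun d => a < d < b) s /\
    filterlim s (at_right a) (Rbar_locally p_infty) /\
    filterlim s (at_left b) (locally 0).
Proof.
  intros HNpos HN HD HC He Hf0 Hf.
  set (h := elasticity N dN).
  assert (Hdec : strictly_decreasing_on positive h) by apply He.
  set (s := fun d => epsilon (inhabits 0) (fun x => 0 < x /\ h x = d)).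
  assert (Hs : forall d, a < d < b -> 0 < s d /\ h (s d) = d).
  { intros d Hd. apply epsilon_spec.
    apply (elasticity_reaches N dN dD a b C); auto. }
  assert (Hgt : forall d x, a < d < b -> 0 < x -> d < h x -> x < s d).
  { intros d x Hd Hx Hdx. destruct (Hs d Hd) as [Hp Eh].
    apply Rnot_le_lt; intros [H|H].
    - apply (Hdec _ _ Hp Hx) in H; lra.
    - rewrite H in Eh; lra. }
  assert (Hlt : forall d x, a < d < b -> 0 < x -> h x < d -> s d < x).
  { intros d x Hd Hx Hdx. destruct (Hs d Hd) as [Hp Eh].
    apply Rnot_le_lt; intros [H|H].
    - apply (Hdec _ _ Hx Hp) in H; lra.
    - rewrite <- H in Eh; lra. }
  exists s; split; [|split; [|split]].
  - intros d Hd; split; [|apply Hs, Hd].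
    apply (maximizer_of_elasticity N dN (f d) d); auto; apply Hs, Hd.
  - intros x y Hx Hy Hxy. apply Hlt; auto; [apply Hs; auto|].
    destruct (Hs x Hx) as [_ ->]; exact Hxy.
  - intros P [M HM]; unfold filtermap.
    set (m := Rmax M 1).
    assert (Hm : 0 < m) by (pose proof (Rmax_r M 1); unfold m; lra).
    pose proof (elasticity_gt _ _ _ _ He m Hm) as Hlo.
    pose proof (elasticity_near_0 _ _ _ _ He m Hm) as Hhi.
    fold h in Hlo, Hhi.
    assert (Heps : 0 < h m - a) by lra.
    exists (mkposreal _ Heps); intros d Hball Had.
    apply Rabs_lt_between in Hball.
    unfold minus, plus, opp in Hball; simpl in Hball.
    apply HM, Rle_lt_trans with m; [apply Rmax_l|].
    apply Hgt; lra.
  - intros P [eps HP]; unfold filtermap.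
    pose proof (cond_pos eps) as Hp.
    pose proof (elasticity_gt _ _ _ _ He eps Hp) as Hlo.
    pose proof (elasticity_near_0 _ _ _ _ He eps Hp) as Hhi.
    fold h in Hlo, Hhi.
    assert (Heps : 0 < b - h eps) by lra.
    exists (mkposreal _ Heps); intros d Hball Hdb.
    apply Rabs_lt_between in Hball.
    unfold minus, plus, opp in Hball; simpl in Hball.
    apply HP, Rabs_lt_between.
    unfold minus, plus, opp; simpl.
    assert (Hd : a < d < b) by lra.
    destruct (Hs d Hd) as [Hsd _].
    assert (s d < eps) by (apply Hlt; auto; lra).
    lra.
Qed.

(** * The numerator of E *)

Definition exp_tail (n : nat) (x : R) : R :=
  1 - sum_f_R0 (fun k => x ^ k / INR (fact k)) n * exp (- x).

Definition exp_tail_deriv (n : nat) (x : R) : R :=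
  x ^ n / INR (fact n) * exp (- x).

Lemma is_derive_pow_div_fact (n : nat) (x : R) :
  is_derive (fun t => t ^ S n / INR (fact (S n))) x (x ^ n / INR (fact n)).
Proof.
  assert (Hfact : INR (fact (S n)) = (INR n + 1) * INR (fact n))
    by (rewrite fact_simpl, mult_INR, S_INR; reflexivity).
  rewrite Hfact.
  pose proof (INR_fact_neq_0 n). pose proof (pos_INR n).
  auto_derive; [auto|].
  change (match n with O => 1 | S _ => INR n + 1 end) with (INR (S n)).
  change (Init.Nat.pred (S n)) with n; rewrite S_INR.
  field; split; [assumption|lra].
Qed.

Lemma is_derive_exp_tail (n : nat) (x : R) :
  is_derive (exp_tail n) x (exp_tail_deriv n x).
Proof.
  induction n as [|n IH].
  - unfold exp_tail, exp_tail_deriv; simpl; auto_derive; [trivial|]. lra.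
  - assert (Hstep : forall t,
      exp_tail n t - t ^ S n / INR (fact (S n)) * exp (- t) = exp_tail (S n) t)
      by (intros t; unfold exp_tail; rewrite tech5; ring).
    apply (is_derive_ext _ _ _ _ Hstep).
    replace (exp_tail_deriv (S n) x)
      with (exp_tail_deriv n x - (exp_tail_deriv n x - exp_tail_deriv (S n) x)) by ring.
    apply (is_derive_minus (V := R_NormedModule) (exp_tail n)); [exact IH|].
    replace (exp_tail_deriv n x - exp_tail_deriv (S n) x)
      with (x ^ n / INR (fact n) * exp (- x)
            + x ^ S n / INR (fact (S n)) * (- exp (- x)))
      by (unfold exp_tail_deriv; ring).
    apply (is_derive_mult (fun t => t ^ S n / INR (fact (S n))) (fun t => exp (- t)));
      [apply is_derive_pow_div_fact| |intros; apply Rmult_comm].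
    auto_derive; [auto|ring].
Qed.

Lemma exp_tail_0 (n : nat) : exp_tail n 0 = 0.
Proof.
  assert (H : sum_f_R0 (fun k => 0 ^ k / INR (fact k)) n = 1).
  { induction n as [|n IH]; [simpl; field|].
    rewrite tech5, IH, pow_i by lia. unfold Rdiv; ring. }
  unfold exp_tail; rewrite H, Ropp_0, exp_0; ring.
Qed.

Lemma exp_tail_le_1 (n : nat) (x : R) : 0 < x -> exp_tail n x <= 1.
Proof.
  intros Hx; unfold exp_tail.
  assert (0 <= sum_f_R0 (fun k => x ^ k / INR (fact k)) n * exp (- x)); [|lra].
  apply Rmult_le_pos; [|apply Rlt_le, exp_pos].
  apply cond_pos_sum; intros k.
  apply Rlt_le, Rdiv_lt_0_compat; [apply pow_lt, Hx|apply INR_fact_lt_0].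
Qed.

Lemma exp_tail_deriv_pos (n : nat) (x : R) : 0 < x -> 0 < exp_tail_deriv n x.
Proof.
  intros Hx; apply Rmult_lt_0_compat; [|apply exp_pos].
  apply Rdiv_lt_0_compat; [apply pow_lt, Hx|apply INR_fact_lt_0].
Qed.

Lemma exp_tail_pos (n : nat) (x : R) : 0 < x -> 0 < exp_tail n x.
Proof.
  intros Hx; rewrite <- (exp_tail_0 n).
  apply (derive_pos_increasing _ (exp_tail_deriv n)); trivial.
  - intros; apply is_derive_exp_tail.
  - intros; apply exp_tail_deriv_pos; lra.
Qed.

(** [u * exp_tail_deriv n u] is a multiple of [u ^ (n + 1) * exp (- u)], whose
    logarithmic derivative is [(n + 1) / u - 1]. *)
Lemma is_derive_x_exp_tail_deriv (n : nat) (x : R) :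
  is_derive (fun u => u * exp_tail_deriv n u) x
    ((INR n + 1 - x) * exp_tail_deriv n x).
Proof.
  assert (Hpow : forall u,
    u ^ S n * (exp (- u) / INR (fact n)) = u * exp_tail_deriv n u)
    by (intros u; unfold exp_tail_deriv; simpl; field; apply INR_fact_neq_0).
  apply (is_derive_ext _ _ _ _ Hpow).
  unfold exp_tail_deriv; auto_derive; [auto|].
  change (match n with O => 1 | S _ => INR n + 1 end) with (INR (S n)).
  change (Init.Nat.pred (S n)) with n; rewrite S_INR.
  simpl; field; apply INR_fact_neq_0.
Qed.

Lemma exp_tail_controlled (n : nat) :
  controlled_elasticity (exp_tail n) (exp_tail_deriv n) 0 (INR n + 1).
Proof.
  apply (controlled_elasticity_of_derivative _ _ (fun x => INR n + 1 - x)).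
  - apply exp_tail_0.
  - intros; apply is_derive_exp_tail.
  - intros; apply is_derive_x_exp_tail_deriv.
  - apply exp_tail_deriv_pos.
  - intros x y _ _ H; lra.
  - intros; lra.
  - intros x Hx. unfold elasticity.
    apply Rdiv_lt_0_compat; [|apply exp_tail_pos, Hx].
    apply Rmult_lt_0_compat; [exact Hx|apply exp_tail_deriv_pos, Hx].
Qed.

(** * The numerator of G *)

(** The Taylor remainder of [exp (- u)] after [m] terms, with the sign that
    makes it positive.  Two consecutive remainders add up to a single term of
    the series, and starting at [m = 0] gives the induction on derivatives its
    base. *)
Fixpoint exp_remainder (m : nat) (u : R) : R :=
  match m with
  | O => exp (- u)
  | S k => u ^ k / INR (fact k) - exp_remainder k u
  end.

Lemma exp_remainder_taylor (n : nat) (u : R) :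
  exp_remainder (S n) u =
  (-1) ^ (n + 1) *
  (exp (- u) - sum_f_R0 (fun k => (-1) ^ k * (u ^ k / INR (fact k))) n).
Proof.
  induction n as [|n IH].
  - simpl; field.
  - change (exp_remainder (S (S n)) u)
      with (u ^ S n / INR (fact (S n)) - exp_remainder (S n) u).
    rewrite IH, tech5, Nat.add_1_r, Nat.add_1_r.
    assert (Hsq : (-1) ^ S n * (-1) ^ S n = 1)
      by (rewrite <- Rpow_mult_distr; replace (-1 * -1) with 1 by ring; apply pow1).
    change ((-1) ^ S (S n)) with (-1 * (-1) ^ S n).
    set (q := u ^ S n / INR (fact (S n))). set (p := (-1) ^ S n) in *.
    set (S0 := sum_f_R0 _ n).
    replace (-1 * p * (exp (- u) - (S0 + p * q)))
      with (p * p * q - p * (exp (- u) - S0)) by ring.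
    rewrite Hsq; ring.
Qed.

Lemma exp_remainder_0 (n : nat) : exp_remainder (S n) 0 = 0.
Proof.
  induction n as [|n IH].
  - simpl; rewrite Ropp_0, exp_0; field.
  - change (0 ^ S n / INR (fact (S n)) - exp_remainder (S n) 0 = 0).
    rewrite IH, pow_i by lia. unfold Rdiv; ring.
Qed.

Lemma is_derive_exp_remainder (n : nat) (x : R) :
  is_derive (exp_remainder (S n)) x (exp_remainder n x).
Proof.
  induction n as [|n IH].
  - simpl; auto_derive; auto; field.
  - change (is_derive (fun u => u ^ S n / INR (fact (S n)) - exp_remainder (S n) u) x
              (x ^ n / INR (fact n) - exp_remainder n x)).
    apply (is_derive_minus (V := R_NormedModule) (fun u => u ^ S n / INR (fact (S n))));
      [apply is_derive_pow_div_fact|exact IH].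
Qed.

Lemma exp_remainder_pos (m : nat) (x : R) : 0 < x -> 0 < exp_remainder m x.
Proof.
  revert x; induction m as [|m IH]; intros x Hx; [apply exp_pos|].
  rewrite <- (exp_remainder_0 m).
  apply (derive_pos_increasing _ (exp_remainder m)); trivial.
  - intros; apply is_derive_exp_remainder.
  - intros t Ht; apply IH; lra.
Qed.

Lemma exp_remainder_le (n : nat) (x : R) :
  0 < x -> exp_remainder (S n) x <= / INR (fact n) * Rpower x (INR n).
Proof.
  intros Hx; rewrite Rpower_pow by exact Hx; simpl.
  pose proof (exp_remainder_pos n x Hx). unfold Rdiv; lra.
Qed.

(** For [u > 0], the quotient of the derivatives of [u * exp_remainder n u] and of
    [exp_remainder (S n) u]. *)
Definition exp_remainder_log_slope (n : nat) (u : R) : R :=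
  match n with
  | O => 1 - u
  | S k => 1 + elasticity (exp_remainder (S k)) (exp_remainder k) u
  end.

Lemma is_derive_x_exp_remainder (n : nat) (x : R) :
  0 <= x ->
  is_derive (fun u => u * exp_remainder n u) x
    (exp_remainder_log_slope n x * exp_remainder n x).
Proof.
  intros Hx; destruct n as [|n].
  - simpl; auto_derive; [auto|ring].
  - replace (exp_remainder_log_slope (S n) x * exp_remainder (S n) x)
      with (1 * exp_remainder (S n) x + x * exp_remainder n x).
    + apply (is_derive_mult (fun u : R => u) (exp_remainder (S n)) x 1 (exp_remainder n x));
        [apply (is_derive_id (K := R_AbsRing))|apply is_derive_exp_remainder|].
      intros; apply Rmult_comm.
    + unfold exp_remainder_log_slope, elasticity.
      (* At 0 the quotient in the elasticity is multiplied by 0, and the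
         factor [exp_remainder (S n) 0] vanishes as well. *)
      destruct Hx as [Hx|<-].
      * pose proof (exp_remainder_pos (S n) x Hx). field; lra.
      * rewrite exp_remainder_0; ring.
Qed.

(** By induction on [n], since the quotient of derivatives at the next step is
    1 plus the present elasticity.  The lower bound [n] is inherited in the same
    way, from the positivity of the elasticity for [n = 0]. *)
Lemma exp_remainder_controlled (n : nat) :
  controlled_elasticity (exp_remainder (S n)) (exp_remainder n)
    (INR n) (INR n + 1).
Proof.
  induction n as [|n IH];
    [ apply (controlled_elasticity_of_derivative _ _ (exp_remainder_log_slope 0))
    | apply (controlled_elasticity_of_derivative _ _ (exp_remainder_log_slope (S n)))];
    try (intros; apply is_derive_exp_remainder);
    try (intros; apply is_derive_x_exp_remainder; assumption);
    try (intros; apply exp_remainder_pos; assumption);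
    try apply exp_remainder_0.
  - intros x y _ _ H; simpl; lra.
  - intros x Hx; simpl; lra.
  - intros x Hx. unfold elasticity.
    apply Rdiv_lt_0_compat; [|apply exp_remainder_pos, Hx].
    apply Rmult_lt_0_compat; [exact Hx|apply exp_remainder_pos, Hx].
  - intros x y Hx Hy Hxy.
    apply Rplus_lt_compat_l, (elasticity_decreasing _ _ _ _ IH); assumption.
  - intros x Hx. rewrite S_INR; unfold exp_remainder_log_slope.
    pose proof (elasticity_near_0 _ _ _ _ IH x Hx); lra.
  - intros x Hx.
    destruct (elasticity_mean_value (exp_remainder (S (S n))) (exp_remainder (S n))
                (exp_remainder_log_slope (S n)) x) as [c [Hc ->]]; trivial.
    + apply exp_remainder_0.
    + intros; apply is_derive_exp_remainder.
    + intros; apply is_derive_x_exp_remainder; assumption.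
    + intros; apply exp_remainder_pos; assumption.
    + rewrite S_INR; unfold exp_remainder_log_slope.
      pose proof (elasticity_gt _ _ _ _ IH c (proj1 Hc)); lra.
Qed.

(** * The two families of maximizers *)

Theorem mainTheorem3 (n : nat) :
  (exists s : R -> R,
     (forall delta : R, 0 < delta < INR n + 1 ->
        unique (is_maximizer_on half_line (E n delta)) (s delta) /\
        0 < s delta) /\
     strictly_decreasing_on (fun delta => 0 < delta < INR n + 1) s /\
     filterlim s (at_right 0) (Rbar_locally p_infty) /\
     filterlim s (at_left (INR n + 1)) (locally 0)) /\
  (exists u : R -> R,
     (forall delta : R, INR n < delta < INR n + 1 ->
        unique (is_maximizer_on half_line (G n delta)) (u delta) /\
        0 < u delta) /\
     strictly_decreasing_on (fun delta => INR n < delta < INR n + 1) u /\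
     filterlim u (at_right (INR n)) (Rbar_locally p_infty) /\
     filterlim u (at_left (INR n + 1)) (locally 0)).
Proof.
  split.
  - apply (maximizers_of_controlled_elasticity (exp_tail n) (exp_tail_deriv n)
             (fun x => (INR n + 1 - x) * exp_tail_deriv n x) (E n) 0 (INR n + 1) 1).
    + apply exp_tail_pos.
    + intros; apply is_derive_exp_tail.
    + intros; apply is_derive_x_exp_tail_deriv.
    + intros t Ht; rewrite Rpower_O, Rmult_1_r by exact Ht; apply exp_tail_le_1, Ht.
    + apply exp_tail_controlled.
    + intros d; unfold E; destruct (Rlt_dec 0 0); [lra|reflexivity].
    + intros d t Ht; unfold E; destruct (Rlt_dec 0 t); [reflexivity|lra].
  - apply (maximizers_of_controlled_elasticity (exp_remainder (S n)) (exp_remainder n)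
             (fun x => exp_remainder_log_slope n x * exp_remainder n x) (G n)
             (INR n) (INR n + 1) (/ INR (fact n))).
    + apply exp_remainder_pos.
    + intros; apply is_derive_exp_remainder.
    + apply is_derive_x_exp_remainder.
    + apply exp_remainder_le.
    + apply exp_remainder_controlled.
    + intros d; unfold G; destruct (Rlt_dec 0 0); [lra|reflexivity].
    + intros d t Ht; rewrite exp_remainder_taylor; unfold G.
      destruct (Rlt_dec 0 t); [unfold Rdiv; ring|lra].
Qed.
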